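(* Let $G$ be a connected graph of order $n$. Then $pd_s(G)=n-1$ if and only if $G\cong P_3$, $G\cong C_4$, $G\cong K_n-e$, or $G\cong K_1+\bigcup_{i}K_{n_i}$ where the union has more than one component, $n_i\ge 1$ for every $i$ and $\sum_i n_i=n-1$.
   Context: Graphs are finite, simple, connected; $d_G$ is shortest-path distance, $d_G(x,W)=\min\{d_G(x,w):w\in W\}$. A set $W$ strongly resolves different vertices $x,y\notin W$ if $d_G(x,W)=d_G(x,y)+d_G(y,W)$ or $d_G(y,W)=d_G(y,x)+d_G(x,W)$. A vertex partition $\Pi$ is a strong resolving partition if every two different vertices in the same set of $\Pi$ are strongly resolved by some set of $\Pi$; $pd_s(G)$ is the minimum cardinality of such a partition. $K_n-e$ is the complete graph minus one edge; $K_1+H$ denotes the join of a single vertex with $H$ (the vertex is joined to all vertices of $H$); $\bigcup_i K_{n_i}$ is the disjoint union of complete graphs. *)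

(* Defs.v *)
From HB Require Import structures.
From mathcomp Require Import all_boot.
Set Implicit Arguments.
Unset Strict Implicit.
Unset Printing Implicit Defensive.

Record sgraph := SGraph {
  vertex :> finType;
  adj : rel vertex;
  adj_sym : symmetric adj;
  adj_irr : irreflexive adj }.

Definition connected_graph (G : sgraph) : Prop :=
  0 < #|G| /\ forall x y : G, connect (@adj G) x y.

Definition giso (G H : sgraph) : Prop :=
  exists2 f : G -> H, bijective f & forall x y, adj (f x) (f y) = adj x y.

Section StrongPartitionDimension.
Variable G : sgraph.

Definition walk_of_length (x y : G) (k : nat) : bool :=
  [exists p : k.-tuple G, path (@adj G) x p && (last x p == y)].

(* The least length of a walk, equivalently of a path, from x to y. It is less
   than #|G| when y is reachable from x; otherwise [find] returns the default
   #|G|, which a connected graph never attains. *)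
Definition gdist (x y : G) : nat :=
  find (walk_of_length x y) (iota 0 #|G|).

(* The neutral element #|G| exceeds every distance in a connected graph, so it
   only matters for the empty set, which is never a block of a partition. *)
Definition gdist_set (x : G) (W : {set G}) : nat :=
  \big[minn/#|G|]_(w in W) gdist x w.

Definition strongly_resolves (W : {set G}) (x y : G) : bool :=
  [&& x != y, x \notin W, y \notin W &
    (gdist_set x W == gdist x y + gdist_set y W)
    || (gdist_set y W == gdist y x + gdist_set x W)].

Definition strong_resolving_partition (P : {set {set G}}) : bool :=
  partition P [set: G] &&
  [forall A in P, forall x in A, forall y in A,
    (x != y) ==> [exists W in P, strongly_resolves W x y]].

Lemma strong_resolving_partition_exists :
  exists k, [exists P, strong_resolving_partition P && (#|P| == k)].
Proof.
pose P := [set [set x] | x in [set: G]].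
exists #|P|; apply/existsP; exists P; rewrite eqxx andbT; apply/andP; split.
  apply/and3P; split.
  - apply/eqP/setP => x; rewrite inE; apply/bigcupP.
    by exists [set x]; [apply: imset_f | rewrite inE].
  - apply/trivIsetP => _ _ /imsetP[x _ ->] /imsetP[y _ ->] nxy.
    rewrite disjoints1 inE.
    by apply: contraNneq nxy => ->.
  - by apply/imsetP => -[x _ /setP/(_ x)]; rewrite !inE eqxx.
apply/forall_inP => _ /imsetP[z _ ->].
apply/forall_inP => x /set1P->; apply/forall_inP => y /set1P->.
by rewrite eqxx.
Qed.

Definition pd_s : nat := ex_minn strong_resolving_partition_exists.

End StrongPartitionDimension.

Definition complete_graph (n : nat) : sgraph.
Proof.
refine (@SGraph 'I_n (fun x y => x != y) _ _).
- by move=> x y; rewrite eq_sym.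
- by move=> x; rewrite eqxx.
Defined.

Definition path_graph (n : nat) : sgraph.
Proof.
refine (@SGraph 'I_n (fun x y => (x.+1 == y :> nat) || (y.+1 == x :> nat)) _ _).
- by move=> x y; rewrite orbC.
- by move=> x; rewrite orbb -[X in _ == X]addn0 -addn1 eqn_add2l.
Defined.

(* The guard x != y only matters for n = 1, where it excludes a loop. *)
Definition cycle_graph (n : nat) : sgraph.
Proof.
refine (@SGraph 'I_n (fun x y => (x != y) &&
  ((x.+1 %% n == y :> nat) || (y.+1 %% n == x :> nat))) _ _).
- by move=> x y; rewrite eq_sym orbC.
- by move=> x; rewrite eqxx.
Defined.

Definition delete_edge (G : sgraph) (u v : G) : sgraph.
Proof.
refine (@SGraph G (fun x y => adj x y &&
  ~~ ((x == u) && (y == v) || (x == v) && (y == u))) _ _).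
- by move=> x y; rewrite adj_sym orbC ![(_ == u) && _]andbC.
- by move=> x; rewrite adj_irr.
Defined.

Definition join_graph (G H : sgraph) : sgraph.
Proof.
refine (@SGraph (G + H)%type (fun a b =>
  match a, b with
  | inl x, inl y => adj x y
  | inr x, inr y => adj x y
  | _, _ => true
  end) _ _).
- by move=> [x|x] [y|y] //; rewrite adj_sym.
- by move=> [x|x]; rewrite adj_irr.
Defined.

Definition disjoint_union (I : finType) (G : I -> sgraph) : sgraph.
Proof.
refine (@SGraph {i : I & vertex (G i)} (fun a b =>
  (tag a == tag b) && adj (tagged a) (tagged_as a b)) _ _).
- move=> [i x] [j y] /=; rewrite eq_sym; case: eqP => //= ij.
  by move: y; rewrite ij => y; rewrite !tagged_asE adj_sym.
- by move=> [i x] /=; rewrite eqxx tagged_asE adj_irr.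
Defined.

(* Main.v *)
(* A non-complete connected graph always has a resolving partition whose only
   non-singleton block is an edge, so the bound n - 1 means that no partition
   into n - 2 blocks exists. A geodesic a, b, c, d would allow the block
   {a, b, c}, so the diameter is 2, and then a set resolves x, y only if x, y are
   adjacent and exactly one of them has a neighbour in it. Two kinds of
   partitions into n - 2 blocks must still fail: no triangle has its three pairs
   separated by vertices, and for no vertex t are there two disjoint edges joining N(t) to
   the non-neighbours of t. If some t has two non-neighbours, the second
   condition yields a vertex c carrying all these edges; c is universal, and the
   first condition makes adjacency transitive off c. Otherwise the complement
   of G is a matching, and the first condition leaves K_n - e and C_4.

   For the converse, one finds in every resolving partition of each such graph a
   vertex whose removal leaves at most one vertex in every block. *)
Require Import Defs.
From mathcomp Require Import all_boot zify.
Set Implicit Arguments.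
Unset Strict Implicit.
Unset Printing Implicit Defensive.

(** * Distances, geodesics and vertices that separate an edge *)

Section Distance.
Variable G : sgraph.
Implicit Types (x y z t : G) (p : seq G) (W : {set G}).

Lemma adj_neq x y : adj x y -> x != y.
Proof. by apply: contraTneq => ->; rewrite adj_irr. Qed.

Lemma gdist_le_card x y : gdist x y <= #|G|.
Proof. by rewrite -[leqRHS](size_iota 0) find_size. Qed.

Lemma gdist_le_walk x p : path (@adj G) x p -> gdist x (last x p) <= size p.
Proof.
(* [gdist] never exceeds its default [#|G|], so only shorter walks need an argument. *)
move=> xp; case: (ltnP (size p) #|G|) => [ltp|]; last first.
  exact/leq_trans/gdist_le_card.
rewrite leqNgt; apply/negP => /(before_find 0).
rewrite nth_iota // add0n => /negbT/existsP; apply.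
by exists (in_tuple p); rewrite /= xp eqxx.
Qed.

Lemma gdistxx x : gdist x x = 0.
Proof. by apply/eqP; rewrite -leqn0 (@gdist_le_walk x [::]). Qed.

(** A duplicate-free path has fewer than [#|G|] steps, so the search in [gdist] succeeds before its
    default is reached. *)
Lemma gdist_walk x y : connect (@adj G) x y ->
  exists p, [/\ path (@adj G) x p, last x p = y & size p = gdist x y].
Proof.
case/connectP => p0 /shortenP[p xp up _] ->.
have ltp : size p < #|G|.
  by have := card_uniqP up; rewrite /= => <-; exact: max_card.
have hasw : has (walk_of_length x (last x p)) (iota 0 #|G|).
  apply/hasP; exists (size p); first by rewrite mem_iota.
  by apply/existsP; exists (in_tuple p); rewrite /= xp eqxx.
have := nth_find 0 hasw.
rewrite nth_iota ?add0n; last by rewrite -[ltnRHS](size_iota 0) -has_find.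
case/existsP => q /andP[xq /eqP lq].
by exists q; rewrite size_tuple.
Qed.

Lemma gdist_adj x y z : adj x y -> adj y z -> gdist x z <= 2.
Proof.
by move=> xy yz; apply: (@gdist_le_walk x [:: y; z]); rewrite /= xy yz.
Qed.

Lemma adj_gdist_le1 x y : adj x y -> gdist x y <= 1.
Proof. by move=> xy; apply: (@gdist_le_walk x [:: y]); rewrite /= xy. Qed.

Lemma gdist_set_le x w W : w \in W -> gdist_set x W <= gdist x w.
Proof.
move=> wW; rewrite /gdist_set.
elim: (index_enum G) (mem_index_enum w) => // v s IHs.
rewrite inE big_cons => /predU1P[<-|/IHs le]; first by rewrite wW geq_minl.
by case: ifP; rewrite // geq_min le orbT.
Qed.

(** The bound on [k] covers the neutral element [#|G|], which always enters the minimum. *)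
Lemma gdist_set_ge k x W :
  k <= #|G| -> {in W, forall w, k <= gdist x w} -> k <= gdist_set x W.
Proof.
move=> kG kW; rewrite /gdist_set; elim/big_ind: _ => //.
by move=> a b ka kb; rewrite leq_min ka.
Qed.

Lemma gdist_set1 x t : gdist_set x [set t] = gdist x t.
Proof.
apply/eqP; rewrite eqn_leq gdist_set_le ?set11 // gdist_set_ge ?gdist_le_card //.
by move=> w /set1P->.
Qed.

Hypothesis conG : connected_graph G.

Lemma gdist_triangle x y z : gdist x z <= gdist x y + gdist y z.
Proof.
have [p [xp <- <-]] := gdist_walk (conG.2 x y).
have [q [yq <- <-]] := gdist_walk (conG.2 (last x p) z).
by rewrite -last_cat -size_cat gdist_le_walk // cat_path xp.
Qed.

Lemma gdist_gt0 x y : x != y -> 0 < gdist x y.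
Proof.
by case: (gdist_walk (conG.2 x y)) => [[|a p] [_ <- <-]]; rewrite //= eqxx.
Qed.

Lemma gdist_gt1 x y : x != y -> ~~ adj x y -> 1 < gdist x y.
Proof.
case: (gdist_walk (conG.2 x y)) => [[|a [|b p]] [/= xp <- <-]] //.
  by rewrite eqxx.
by move: xp; rewrite andbT => ->.
Qed.

Lemma gdist_le2P x y : gdist x y <= 2 -> x != y -> ~~ adj x y ->
  exists2 z, adj x z & adj z y.
Proof.
case: (gdist_walk (conG.2 x y)) => [[|a [|b [|c p]]] [/= xp <- <-]] // _.
- by rewrite eqxx.
- by move: xp; rewrite andbT => ->.
- by move: xp; rewrite andbT => /andP[? ?]; exists a.
Qed.

(** The distance condition of [strongly_resolves] for the set [[set t]]: some geodesic through [x]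
    and [y] ends at [t]. *)
Definition on_geodesic x y t :=
  (gdist x t == gdist x y + gdist y t) || (gdist y t == gdist y x + gdist x t).

Definition separates x y t := [&& t != x, t != y & adj t x != adj t y].

Lemma on_geodesicC x y t : on_geodesic x y t = on_geodesic y x t.
Proof. by rewrite /on_geodesic orbC. Qed.

(** The end of the edge that is not adjacent to [t] has distance exactly 2 from [t], through the
    other end. *)
Lemma separates_geodesic x y t : adj x y -> separates x y t -> on_geodesic x y t.
Proof.
move=> xy /and3P[tx ty]; wlog ntx : x y xy tx ty / ~~ adj t x => [hw|].
  case tx' : (adj t x); last by move=> h; apply: hw; rewrite ?tx'.
  case ty' : (adj t y) => // _; rewrite on_geodesicC.
  by apply: hw; rewrite ?ty' ?tx' // adj_sym.
rewrite (negPf ntx); case ty' : (adj t y) => // _.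
have yt : adj y t by rewrite adj_sym.
have d1 (a b : G) : adj a b -> gdist a b = 1.
  move=> ab; apply/eqP; rewrite eqn_leq adj_gdist_le1 //.
  by rewrite gdist_gt0 // adj_neq.
rewrite /on_geodesic (d1 _ _ xy) (d1 _ _ yt); apply/orP; left.
rewrite eqn_leq (gdist_adj xy yt).
by rewrite gdist_gt1 1?eq_sym // adj_sym.
Qed.

End Distance.

(** * Upper bounds from merging vertices, and consequences of being resolved by a block *)

Section Partitions.
Variable G : sgraph.
Hypothesis conG : connected_graph G.
Implicit Types (x y z t u v w : G) (W : {set G}) (P : {set {set G}}).

Lemma pd_s_le P : strong_resolving_partition P -> pd_s G <= #|P|.
Proof.
rewrite /pd_s => sP; case: ex_minnP => k _; apply.
by apply/existsP; exists P; rewrite sP eqxx.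
Qed.

Lemma pd_s_ge k :
  (forall P, strong_resolving_partition P -> k <= #|P|) -> k <= pd_s G.
Proof.
rewrite /pd_s => kP; case: ex_minnP => m /existsP[P /andP[sP /eqP <-]] _.
exact: kP.
Qed.

(* [f] merges vertices; every merged pair must be resolved by a vertex [t] that
   stays alone in its block. *)
Lemma pd_s_le_merge (f : G -> G) :
  (forall x y, x != y -> f x = f y ->
     exists2 t, (forall z, f z = f t -> z = t) & on_geodesic x y t) ->
  pd_s G <= #|[set f x | x : G]|.
Proof.
move=> hf; pose P := preim_partition f [set: G].
have partP : partition P [set: G] := preim_partitionP f [set: G].
have blockE x : pblock P x = [set y | f y == f x].
  apply/setP => y; rewrite inE eq_sym; apply: pblock_equivalence_partition => //.
  by split=> // /eqP ->.
have inP x : pblock P x \in P.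
  by apply: pblock_mem; rewrite (cover_partition partP).
have blockP A x : A \in P -> x \in A -> A = pblock P x.
  move=> AP xA; apply/esym/def_pblock => //.
  by case/and3P: partP.
have : strong_resolving_partition P.
  rewrite /strong_resolving_partition partP /=.
  apply/forall_inP => A AP; apply/forall_inP => x xA; apply/forall_inP => y.
  rewrite (blockP A x) // blockE inE => /eqP fxy; apply/implyP => nxy.
  have [t tf xyt] := hf x y nxy (esym fxy).
  have tE : pblock P t = [set t].
    apply/setP => z; rewrite blockE !inE.
    by apply/eqP/eqP => [/tf|->].
  (* [t] shares its value under [f] with no other vertex, while [x] and [y] share theirs; hence
     neither is [t]. *)
  have nxt : x != t.
    by apply: contraNneq nxy => xt; rewrite -xt in tf *; rewrite (tf y).
  have nyt : y != t.
    by apply: contraNneq nxy => yt; rewrite -yt in tf *; rewrite (tf x).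
  apply/exists_inP; exists [set t]; first by rewrite -tE.
  by rewrite /strongly_resolves nxy !inE nxt nyt !gdist_set1.
move/pd_s_le/leq_trans; apply.
(* The blocks are the fibres of [f], so there are at most as many blocks as values. *)
have -> : P = [set f @^-1: [set a] | a in [set f x | x : G]].
  apply/setP => A; apply/idP/imsetP => [AP|[_ /imsetP[x _ ->] ->]].
    have /set0Pn[x xA] : A != set0.
      by apply: contraTneq AP => ->; case/and3P: partP.
    exists (f x); first exact: imset_f.
    by rewrite (blockP A x) // blockE; apply/setP => y; rewrite !inE.
  suff -> : f @^-1: [set f x] = pblock P x by [].
  by rewrite blockE; apply/setP => y; rewrite !inE.
exact: leq_imset_card.
Qed.

(** The edge becomes the only block with two vertices, and the singleton of [t] resolves it. *)
Lemma pd_s_merge_edge x y t : adj x y -> separates x y t -> pd_s G <= #|G| - 1.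
Proof.
move=> xy sep; have nxy := adj_neq xy; have /and3P[tx ty _] := sep.
pose f z := if z == y then x else z.
apply: leq_trans (@pd_s_le_merge f _) _ => [a b nab fab|].
  exists t => [z|].
    rewrite /f (negPf ty); case: eqP => // _ /esym/eqP.
    by rewrite (negPf tx).
  have geo := separates_geodesic conG xy sep.
  move: nab fab; rewrite /f; case: (eqVneq a y) => [->|ay].
    by case: (eqVneq b y) => // by_ _ <-; rewrite on_geodesicC.
  case: (eqVneq b y) => [-> _ ->|] // _ /eqP nab abE.
  by case: nab.
rewrite subn1 -(cardC1 y).
apply/subset_leq_card/subsetP => _ /imsetP[z _ ->].
by rewrite !inE /f; case: (eqVneq z y).
Qed.

(** Vertex [b] is merged into [a] and [d] into [c], which removes two values. This makes two blocks
    of size 2 or, when [a = c], one block of size 3, whose third pair is covered by the last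
    hypothesis. *)
Lemma pd_s_merge2 (a b c d : G) :
    a != b -> a != d -> c != b -> c != d -> b != d ->
    (exists2 t, t \notin [:: a; b; c; d] & on_geodesic a b t) ->
    (exists2 t, t \notin [:: a; b; c; d] & on_geodesic c d t) ->
    (a = c -> exists2 t, t \notin [:: a; b; c; d] & on_geodesic b d t) ->
  pd_s G <= #|G| - 2.
Proof.
move=> ab ad cb cd bd hab hcd hbd.
pose f z := if z == b then a else if z == d then c else z.
have alone t : t \notin [:: a; b; c; d] -> forall z, f z = f t -> z = t.
  rewrite !inE !negb_or => /and4P[ta tb tc td] z.
  rewrite /f (negPf tb) (negPf td).
  case: eqP => _; first by move=> at_; rewrite at_ eqxx in ta.
  by case: eqP => _ // ct; rewrite ct eqxx in tc.
apply: leq_trans (@pd_s_le_merge f _) _ => [x y nxy fxy|].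
  suff [t tn geo] : exists2 t, t \notin [:: a; b; c; d] & on_geodesic x y t.
    by exists t; first exact: alone.
  have fa z : z != b -> z != d -> f z = z.
    by rewrite /f => /negPf -> /negPf ->.
  have fb : f b = a by rewrite /f eqxx.
  have fd : f d = c by rewrite /f eqxx eq_sym (negPf bd).
  have sym (u v : G) : (exists2 t, t \notin [:: a; b; c; d] & on_geodesic u v t) ->
      exists2 t, t \notin [:: a; b; c; d] & on_geodesic v u t.
    by case=> t; exists t; rewrite // on_geodesicC.
  move: nxy fxy.
  case: (eqVneq x b) => [->|xb]; [|case: (eqVneq x d) => [->|xd]];
    (case: (eqVneq y b) => [->|yb]; [|case: (eqVneq y d) => [->|yd]]);
    rewrite ?eqxx // ?fb ?fd ?[f x]fa ?[f y]fa // => nxy e.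
  - by rewrite -e; apply: sym.
  - by apply/sym/hbd/esym.
  - by rewrite -e; apply: sym.
  - by rewrite e.
  - by rewrite e.
  - by rewrite e eqxx in nxy.
have -> : #|G| - 2 = #|~: [set b; d]|.
  by rewrite cardsCs setCK cards2 bd.
apply/subset_leq_card/subsetP => _ /imsetP[z _ ->].
rewrite !inE negb_or /f; case: (eqVneq z b) => [_|zb]; first by rewrite ab.
by case: (eqVneq z d) => [_|zd]; rewrite ?cb ?cd // zb.
Qed.

Lemma same_block_resolved P x y :
    strong_resolving_partition P -> x != y -> pblock P x = pblock P y ->
  exists2 W, W \in P & strongly_resolves W x y.
Proof.
case/andP => partP /forall_inP resP nxy xyP.
have cov z : z \in cover P by rewrite (cover_partition partP) inE.
have /forall_inP/(_ x) := resP _ (pblock_mem (cov x)).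
rewrite mem_pblock cov => /(_ isT)/forall_inP/(_ y).
rewrite {1}xyP mem_pblock cov nxy => /(_ isT)/exists_inP[W WP sW].
by exists W.
Qed.

Lemma card_partition_ge P (D : {set G}) :
    strong_resolving_partition P -> {in D &, injective (pblock P)} ->
  #|D| <= #|P|.
Proof.
case/andP => partP _ injP; rewrite -(card_in_imset injP).
apply/subset_leq_card/subsetP => _ /imsetP[x _ ->].
by apply: pblock_mem; rewrite (cover_partition partP) inE.
Qed.

Lemma block_neq0 P W : strong_resolving_partition P -> W \in P ->
  exists w, w \in W.
Proof.
case/andP => /and3P[_ _ n0] _ WP; apply/set0Pn.
by apply: contraNneq n0 => <-.
Qed.

(** The distance to [W] in the resolving equation is at most [k] and is a sum of two positive
    terms. *)
Lemma resolves_diam k P W x y : (forall a b : G, gdist a b <= k) ->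
    strong_resolving_partition P -> W \in P -> strongly_resolves W x y ->
  1 < k.
Proof.
move=> diam sP WP /and4P[nxy xW yW /orP H].
have [w wW] := block_neq0 sP WP.
have le z : gdist_set z W <= k by apply: leq_trans (gdist_set_le _ wW) _.
have ge z : z \notin W -> 0 < gdist_set z W.
  move=> zW; apply: gdist_set_ge => [|v vW]; first by apply/card_gt0P; exists z.
  by apply: gdist_gt0 => //; apply: contraNneq zW => ->.
have xy1 : 0 < gdist x y by apply: gdist_gt0.
have yx1 : 0 < gdist y x by apply: gdist_gt0; rewrite // eq_sym.
case: H => /eqP e; [apply: leq_trans (le x)|apply: leq_trans (le y)];
  by rewrite e (@leq_add 1 1) // ge.
Qed.

(** With diameter at most 2 the resolving equation can only read 2 = 1 + 1, where [a] is the far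
    vertex and [b] the near one. *)
Lemma resolves_diam2 P W x y : (forall a b : G, gdist a b <= 2) ->
    strong_resolving_partition P -> W \in P -> strongly_resolves W x y ->
  exists a b : G, [/\ (a = x /\ b = y) \/ (a = y /\ b = x), adj a b,
    a \notin W, {in W, forall w, ~~ adj a w} & exists2 w, w \in W & adj b w].
Proof.
move=> diam sP WP /and4P[nxy xW yW H].
wlog {H} e : x y nxy xW yW / gdist_set x W = gdist x y + gdist_set y W => [hw|].
  case/orP: H => /eqP; first exact: hw.
  case/(hw y x); rewrite // 1?eq_sym // => a [b [ab ? ? ? ?]].
  by exists a, b; split=> //; case: ab; [right|left].
have [w wW] := block_neq0 sP WP.
have le z : gdist_set z W <= 2 by apply: leq_trans (gdist_set_le _ wW) _.
have y1 : 0 < gdist_set y W.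
  apply: gdist_set_ge => [|v vW]; first by apply/card_gt0P; exists y.
  by apply: gdist_gt0 => //; apply: contraNneq yW => ->.
have xy1 : 0 < gdist x y by apply: gdist_gt0.
(* Keeps the neutral element of the minimum above the lower bound 2 in the last application of
   [gdist_set_ge]. *)
have G2 : 2 <= #|G|.
  by have := subset_leq_card (subsetT [set x; y]); rewrite cards2 nxy cardsT.
have := le x; rewrite e => le2.
have adjxy : adj x y.
  apply: contraTT le2 => nadj; rewrite -ltnNge -addn1 leq_add //.
  exact: gdist_gt1.
exists x, y; split; [by left|by []|by []| |].
  move=> v vW; apply: contraTN (leq_add xy1 y1) => xv.
  by rewrite -e -ltnNge ltnS (leq_trans (gdist_set_le _ vW)) // adj_gdist_le1.
apply/exists_inP; apply: contraTT le2; rewrite negb_exists_in => /forall_inP ny.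
rewrite -ltnNge -(addn1 2) addnC leq_add //; apply: gdist_set_ge => // v vW.
by apply: gdist_gt1; [|apply: contraNneq yW => ->|apply: ny].
Qed.

End Partitions.

(** * Structural conditions describing the extremal graphs *)

(** This says that the complement of [G] is a matching. *)
Definition unique_nonneighbor (G : sgraph) :=
  forall x y z : G,
    y != x -> z != x -> ~~ adj x y -> ~~ adj x z -> y = z.

Lemma unique_nonneighbor_adj (G : sgraph) (x x' y : G) :
    unique_nonneighbor G -> x != x' -> ~~ adj x x' -> y != x -> y != x' ->
  adj x y.
Proof.
move=> uniqG xx' nx yx; apply: contraNT => nxy; apply/eqP.
by apply: (uniqG x); rewrite // eq_sym.
Qed.

(* Connected non-complete graphs with this property and [unique_nonneighbor]
   are exactly [K_n - e] (n >= 3) and [C_4]. *)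
Definition pairs_exhaust (G : sgraph) :=
  forall u u' v v' : G, u != u' -> v != v' -> ~~ adj u u' -> ~~ adj v v' ->
    v \in [:: u; u'] \/ forall w, w \in [:: u; u'; v; v'].

(* [G] is the join of [c] with at least two disjoint cliques. *)
Definition clique_star (G : sgraph) (c : G) :=
  [/\ forall x : G, x != c -> adj c x,
      forall x y z : G, x != c -> y != c -> z != c ->
        adj x y -> adj y z -> x != z -> adj x z
    & exists x y : G, [/\ x != c, y != c, x != y & ~~ adj x y]].

(** * Structure forced by the value n - 1 *)

Section Extremal.
Variable G : sgraph.
Hypothesis conG : connected_graph G.
Implicit Types x y z t u v w : G.

(** With diameter at most 1 no pair is resolved, so every block is a singleton. *)
Lemma complete_pd_s_ge :
  (forall x y, x != y -> adj x y) -> #|G| <= pd_s G.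
Proof.
move=> complG; apply: pd_s_ge => P sP; rewrite -cardsT.
apply: (card_partition_ge sP) => x y _ _ /(same_block_resolved sP) res.
apply/eqP/negPn/negP => /res[W WP /(resolves_diam conG _ sP WP) k].
suff : 1 < 1 by []; apply: k => a b.
by case: (eqVneq a b) => [->|/complG/adj_gdist_le1 //]; rewrite gdistxx.
Qed.

Hypothesis pdG : pd_s G = #|G| - 1.

(** Two different vertices give [2 <= #|G|], so the truncated subtractions are genuine. *)
Lemma pd_s_gt2 x y : x != y -> ~~ (pd_s G <= #|G| - 2).
Proof.
move=> xy; have := max_card [set x; y]; rewrite cards2 xy pdG /=; lia.
Qed.

Lemma extremal_not_complete : exists x y, x != y /\ ~~ adj x y.
Proof.
have [/forallP complG|] := boolP [forall x, forall y, (x != y) ==> @adj G x y].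
  have := complete_pd_s_ge (fun x y => implyP (forallP (complG x) y)).
  by rewrite pdG; case: conG; lia.
rewrite negb_forall => /existsP[x]; rewrite negb_forall => /existsP[y].
by rewrite negb_imply => /andP[? ?]; exists x, y.
Qed.

(** On a geodesic of length at least 3, the end [y] resolves every pair among the first three
    vertices [x], [b], [c]. *)
Lemma extremal_diam x y : gdist x y <= 2.
Proof.
rewrite leqNgt; apply/negP => d3.
have [p [xp py pk]] := gdist_walk (conG.2 x y).
move: d3; rewrite -pk; case: p xp py pk => [|b [|c p]] //= xp py pk pgt.
case/and3P: xp => xb bc cp.
have dxb := adj_gdist_le1 xb; have dbc := adj_gdist_le1 bc.
have dcy := gdist_le_walk cp; rewrite py in dcy.
have dby : gdist b y <= (size p).+1.
  by rewrite -py; apply: (@gdist_le_walk G b (c :: p)); rewrite /= bc.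
have dxc := gdist_adj xb bc.
(* Together with the upper bounds above, these inequalities determine all distances among [x], [b],
   [c], [y]. *)
have txb := gdist_triangle conG x b y.
have txc := gdist_triangle conG x c y.
have tbc := gdist_triangle conG b c y.
have xc : x != c by apply: contraTneq dcy => <-; lia.
have yx : y != x by apply: contraTneq pgt => yx; rewrite -yx gdistxx in pk; lia.
have yb : y != b by apply: contraTneq txb => e;
  rewrite -e in dxb *; rewrite gdistxx; lia.
have yc : y != c by apply: contraTneq txc => e;
  rewrite -e in dxc *; rewrite gdistxx; lia.
have /negP[] := pd_s_gt2 xc.
have yn : y \notin [:: x; b; x; c] by rewrite !inE !negb_or yx yb yc.
apply: (@pd_s_merge2 G x b x c);
  rewrite ?xc ?(adj_neq xb) ?(adj_neq bc) //=;
  try move=> _; exists y => //; rewrite /on_geodesic; apply/orP; left;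
  apply/eqP; lia.
Qed.

(** Otherwise the triangle could be merged into one block, each of its pairs being resolved by a
    separating vertex. *)
Lemma extremal_triangle x y z : adj x y -> adj y z -> adj x z ->
  (exists t, separates x y t) -> (exists t, separates y z t) ->
  (exists t, separates x z t) -> False.
Proof.
move=> xy yz xz [t sxy] [u syz] [v sxz].
have /negP[] := pd_s_gt2 (adj_neq xy).
(* The third corner is adjacent to both ends of an edge of the triangle, so it does not separate
   them. *)
have sepn a b c w : adj a c -> adj b c -> separates a b w -> w \notin [:: a; b; c].
  move=> ac bc /and3P[wa wb ab]; rewrite !inE !negb_or wa wb andTb.
  by apply: contraNneq ab => ->; rewrite ![adj c _]adj_sym ac bc.
apply: (@pd_s_merge2 G x y x z);
  rewrite ?adj_neq //; try move=> _.
- exists t; last exact: separates_geodesic.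
  by have := sepn _ _ _ _ xz yz sxy; rewrite !inE !negb_or => /and3P[-> -> ->].
- exists v; last exact: separates_geodesic.
  have := sepn _ _ _ _ xy _ sxz; rewrite adj_sym yz => /(_ isT).
  by rewrite !inE !negb_or => /and3P[-> -> ->].
- exists u; last exact: separates_geodesic.
  have := sepn y z x u; rewrite ![adj _ x]adj_sym xy xz => /(_ isT isT syz).
  by rewrite !inE !negb_or => /and3P[-> -> ->].
Qed.

(** If both equalities failed, the two edges would be disjoint, since [t] is adjacent to [y] and [w]
    but not to [x] and [z]. Both could then be blocks resolved by [t]. *)
Lemma extremal_matching t x y z w : adj x y -> adj z w ->
    ~~ adj t x -> ~~ adj t z -> t != x -> t != z -> adj t y -> adj t w ->
  x = z \/ y = w.
Proof.
move=> xy zw tx tz ntx ntz ty tw.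
case: (eqVneq x z) => [|xz]; [by left | case: (eqVneq y w) => [|yw]; [by right|]].
have /negP[] := pd_s_gt2 xz.
have nty := adj_neq ty; have ntw := adj_neq tw.
have tn : t \notin [:: x; y; z; w] by rewrite !inE !negb_or ntx nty ntz ntw.
have xw : x != w by apply: contraNneq tx => ->.
have zy : z != y by apply: contraNneq tz => ->.
apply: (@pd_s_merge2 G x y z w) => //;
  rewrite ?adj_neq //; try (by move=> /eqP; rewrite (negPf xz)).
  by exists t; rewrite // separates_geodesic // /separates ntx nty ty (negPf tx).
by exists t; rewrite // separates_geodesic // /separates ntz ntw tw (negPf tz).
Qed.

Lemma extremal_clique_star t u v : t != u -> t != v -> u != v ->
  ~~ adj t u -> ~~ adj t v -> exists c, @clique_star G c.
Proof.
move=> tu tv uv ntu ntv.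
have nbr m : t != m -> ~~ adj t m -> exists2 c, adj t c & adj c m.
  by move=> tm ntm; apply: (gdist_le2P conG) => //; exact: extremal_diam.
have [c tc cu] := nbr u tu ntu.
(* The edges between the neighbours and the non-neighbours of [t] pairwise
   meet, and every non-neighbour lies on one, so they all contain [c]. *)
have uniq_v w : adj t w -> adj w v -> w = c.
  move=> tw wv; rewrite adj_sym in wv; rewrite adj_sym in cu.
  have [/eqP|//] := extremal_matching wv cu ntv ntu tv tu tw tc.
  by rewrite eq_sym (negPf uv).
have cv : adj c v by have [w tw wv] := nbr v tv ntv; rewrite -(uniq_v w).
have only m w : t != m -> ~~ adj t m -> adj t w -> adj w m -> w = c.
  move=> tm ntm tw wm; case: (eqVneq m v) => [mv|nmv].
    by apply: uniq_v; rewrite // -mv.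
  rewrite adj_sym in wm; rewrite adj_sym in cv.
  by have [/eqP|//] := extremal_matching wm cv ntm ntv tm tv tw tc;
    rewrite (negPf nmv).
have univ x : x != c -> adj c x.
  case: (eqVneq t x) => [<- _|tx xc]; first by rewrite adj_sym.
  case: (boolP (adj t x)) => [adjtx|ntx]; last first.
    by have [w tw wx] := nbr x tx ntx; rewrite -(only x w).
  have nxu : ~~ adj x u by apply: contraNN xc => /(only u x tu ntu adjtx) ->.
  have nexu : x != u by apply: contraTneq adjtx => ->.
  (* If [z] is a neighbour of [t], it must be [c]; if not, the edge from [x] to [z] would force
     [x = c]. *)
  have [z xz zu] := gdist_le2P conG (extremal_diam x u) nexu nxu.
  case: (boolP (adj t z)) => [tz|ntz].
    by rewrite -(only u z) // adj_sym.
  have ntez : t != z by apply: contraNneq ntu => ->.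
  by rewrite (only z x ntez ntz) ?eqxx // in xc.
exists c; split=> //; last first.
  exists t, u; split=> //; first by rewrite adj_neq.
  by apply: contraNneq ntu => ->.
move=> x y z xc yc zc xy yz xz; apply/negPn/negP => nxz.
(* Vertex [z] separates [x] from both [c] and [y]; it remains to separate [c] from [y] by some
   non-neighbour [w] of [y]. *)
apply: (@extremal_triangle c x y); rewrite ?univ //.
- exists z; rewrite /separates zc eq_sym xz /= adj_sym univ //.
  by rewrite adj_sym (negPf nxz).
- exists z; rewrite /separates eq_sym xz (eq_sym z) (adj_neq yz) /=.
  by rewrite (adj_sym z x) (negPf nxz) adj_sym yz.
(* Either [t] or [u] serves, because [c] is their only common neighbour. *)
have [w [wc wy nwy]] : exists w, [/\ w != c, w != y & ~~ adj w y].
  case: (eqVneq t y) => [<-|ty].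
    exists u; rewrite adj_sym (eq_sym u t); split=> //.
    by apply: contraNneq ntu => ->.
  case: (boolP (adj t y)) => [adjty|nty]; last first.
    by exists t; rewrite ty (adj_neq tc).
  exists u; split; first by apply: contraNneq ntu => ->.
    by apply: contraNneq ntu => ->.
  by rewrite adj_sym; apply: contraNN yc => /(only u y tu ntu adjty) ->.
by exists w; rewrite /separates wc wy (negPf nwy) adj_sym univ.
Qed.

(** A vertex [w] outside both pairs would form a triangle with [u] and [v]. Then [u'] separates [u]
    from [v] and [w], and [v'] separates [v] from [w]. *)
Lemma extremal_pairs : unique_nonneighbor G -> pairs_exhaust G.
Proof.
move=> uniqG u u' v v' uu' vv' nu nv.
case: (boolP (v \in [:: u; u'])) => [|vn]; [by left | right => w].
rewrite !inE negb_or in vn; case/andP: vn => vu vu'.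
apply/negPn/negP; rewrite !inE !negb_or => /and4P[wu wu' wv wv'].
have adj_of := unique_nonneighbor_adj uniqG.
have nu' : ~~ adj u' u by rewrite adj_sym.
have u'u : u' != u by rewrite eq_sym.
have uv := adj_of _ _ _ uu' nu vu vu'.
have uw := adj_of _ _ _ uu' nu wu wu'.
have vw := adj_of _ _ _ vv' nv wv wv'.
have u'v := adj_of _ _ _ u'u nu' vu' vu.
have u'w := adj_of _ _ _ u'u nu' wu' wu.
have v'v : v' != v by rewrite eq_sym.
have nv' : ~~ adj v' v by rewrite adj_sym.
have v'w := adj_of _ _ _ v'v nv' wv' wv.
apply: (extremal_triangle uv vw uw).
- by exists u'; rewrite /separates u'u adj_neq // u'v (negPf nu').
- by exists v'; rewrite /separates v'v adj_neq // v'w (negPf nv').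
- by exists u'; rewrite /separates u'u adj_neq // u'w (negPf nu').
Qed.

Lemma extremal_structure :
  (exists c, @clique_star G c) \/ unique_nonneighbor G /\ pairs_exhaust G.
Proof.
pose Q t u v := [&& t != u, t != v, u != v, ~~ adj t u & ~~ adj t v].
have [/existsP[t /existsP[u /existsP[v /and5P[tu tv uv ntu ntv]]]]|nQ] :=
    boolP [exists t : G, exists u, exists v, Q t u v].
  by left; apply: extremal_clique_star tu tv uv ntu ntv.
suff uniqG : unique_nonneighbor G by right; split=> //; apply: extremal_pairs.
move=> t u v ut vt ntu ntv; apply/eqP; apply: contraNT nQ => uv.
apply/existsP; exists t; apply/existsP; exists u; apply/existsP; exists v.
by rewrite /Q uv ntu ntv ![t == _]eq_sym ut vt.
Qed.

End Extremal.

(** * The structural conditions yield the value n - 1 *)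

Section Converse.
Variable G : sgraph.
Hypothesis conG : connected_graph G.
Implicit Types x y z u v w : G.

(** Vertices other than [v] then lie in pairwise different blocks; the choice of [v] may depend on
    [P]. *)
Lemma pd_s_ge_off :
  (forall P, strong_resolving_partition P -> exists v, forall x y W,
     x != v -> y != v -> pblock P x = pblock P y -> W \in P ->
     ~~ strongly_resolves W x y) ->
  #|G| - 1 <= pd_s G.
Proof.
move=> offP; apply: pd_s_ge => P sP; have [v hv] := offP P sP.
rewrite subn1 -(cardsC1 v); apply: (card_partition_ge sP) => x y.
rewrite !inE => xv yv xyP; apply/eqP/negPn/negP => xy.
have [W WP sW] := same_block_resolved sP xy xyP.
by move/negP: (hv x y W xv yv xyP WP); apply.
Qed.

(** The edge from [c] to [x0] is separated by [y0]. Conversely, a block resolving a pair off [c]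
    would contradict transitivity of adjacency there. *)
Lemma clique_star_pd_s c : @clique_star G c -> pd_s G = #|G| - 1.
Proof.
case=> univ trans [x0 [y0 [x0c y0c xy0 nxy0]]]; apply/eqP; rewrite eqn_leq.
rewrite (@pd_s_merge_edge G conG c x0 y0) ?univ //=; last first.
  rewrite /separates y0c eq_sym xy0 /= adj_sym univ //.
  by rewrite adj_sym (negPf nxy0).
apply: pd_s_ge_off => P sP; exists c => x y W xc yc _ WP; apply/negP.
have diam a b : @gdist G a b <= 2.
  case: (eqVneq a b) => [->|ab]; first by rewrite gdistxx.
  case: (eqVneq a c) => [ac|ac].
    by rewrite ac in ab *; rewrite leqW // adj_gdist_le1 // univ // eq_sym.
  case: (eqVneq b c) => [->|bc].
    by rewrite leqW // adj_gdist_le1 // adj_sym univ.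
  by apply: (gdist_adj (y := c)); rewrite ?univ // adj_sym univ.
case/(resolves_diam2 conG diam sP WP) => a [b [abE ab aW nW [w wW bw]]].
have [ac bc] : a != c /\ b != c by case: abE => -[-> ->].
have /negP[] := nW w wW; apply: (trans a b w) => //.
(* The block contains no neighbour of [a], hence not [c]. *)
- by apply: contraTneq wW => ->;
    apply: contraTN (univ a ac) => /nW; rewrite adj_sym.
- by apply: contraNneq aW => ->.
Qed.

(** A resolving block is the single non-neighbour [w] of some [a] in the resolved pair, and [a] is
    the vertex to leave out. A resolved pair avoiding [a] would give a second non-adjacent pair and
    a fifth vertex [b'], against [pairs_exhaust]. *)
Lemma pairs_exhaust_pd_s u0 v0 : unique_nonneighbor G -> pairs_exhaust G ->
  u0 != v0 -> ~~ adj u0 v0 -> pd_s G = #|G| - 1.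
Proof.
move=> uniqG pairsG uv0 nuv0.
have common x y : x != y -> ~~ adj x y -> exists2 z, adj x z & adj z y.
  move=> xy nxy; have [[|z p] [/= xp py _]] := gdist_walk (conG.2 x y).
    by rewrite py eqxx in xy.
  case/andP: xp => xz _; exists z => //; rewrite adj_sym.
  (* Otherwise [x] and [z] would be two non-neighbours of [y]. *)
  apply: contraTT xz => nyz.
  case: (eqVneq z y) => [->//|zy].
  by rewrite (uniqG y z x) ?adj_irr // adj_sym.
have diam x y : gdist x y <= 2.
  case: (eqVneq x y) => [->|xy]; first by rewrite gdistxx.
  case: (boolP (adj x y)) => [/adj_gdist_le1/leqW //|/(common x y xy)[z]].
  exact: gdist_adj.
apply/eqP; rewrite eqn_leq; apply/andP; split.
  have [z uz zv] := common _ _ uv0 nuv0.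
  apply: (@pd_s_merge_edge G conG z u0 v0); first by rewrite adj_sym.
  rewrite /separates eq_sym (adj_neq zv) eq_sym uv0 /= adj_sym zv.
  by rewrite adj_sym (negPf nuv0).
apply: pd_s_ge_off => P sP.
have in_block x y : pblock P x = pblock P y -> x \in pblock P y.
  by move=> <-; rewrite mem_pblock;
    case/andP: sP => /cover_partition -> _; rewrite inE.
have key x y W : pblock P x = pblock P y -> W \in P -> strongly_resolves W x y ->
    exists a b w, [/\ (a = x /\ b = y) \/ (a = y /\ b = x),
      pblock P w = [set w], a != w & ~~ adj a w].
  move=> xyP WP /(resolves_diam2 conG diam sP WP).
  move=> [a [b [abE ab aW nW [w wW bw]]]].
  have aw v : v \in W -> v != a by apply: contraTneq => ->.
  exists a, b, w; split=> //; [|by rewrite eq_sym aw|exact: nW].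
  have -> : pblock P w = W.
    by apply: def_pblock; case/andP: sP => /and3P[].
  apply/setP => v; rewrite inE; apply/idP/eqP => [vW|-> //].
  by apply: (uniqG a); rewrite ?aw ?nW.
pose bad x y W :=
  [&& x != y, pblock P x == pblock P y, W \in P & strongly_resolves W x y].
have [/existsP[x /existsP[y /existsP[W /and4P[xy /eqP xyP WP sW]]]]|nbad] :=
    boolP [exists x, exists y, exists W, bad x y W]; last first.
  (* No pair in a common block is resolved, so any vertex may be left out. *)
  exists u0 => x y W _ _ xyP WP; apply: contraNN nbad => sW.
  apply/existsP; exists x; apply/existsP; exists y; apply/existsP; exists W.
  by rewrite /bad xyP eqxx WP sW; case/and4P: sW => ->.
have [a [b [w [_ wP aw naw]]]] := key x y W xyP WP sW.
exists a => p q V pa qa pqP VP; apply/negP => sV.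
have [a' [b' [w' [abE w'P aw' naw']]]] := key p q V pqP VP sV.
have {abE} [a'a b'a a'b' abP] :
    [/\ a' != a, b' != a, a' != b' & pblock P a' = pblock P b'].
  by case/and4P: sV => pq _ _ _; case: abE => -[-> ->]; rewrite 1?[q == p]eq_sym.
(* The blocks of [w] and [w'] are singletons, while [a'] and [b'] share a block. *)
have b'w : b' != w.
  apply: contraNneq a'b' => e; have := in_block _ _ abP.
  by rewrite e wP inE.
have a'w : a' != w.
  apply: contraNneq a'b' => e; have := in_block _ _ (esym abP).
  by rewrite e wP inE eq_sym.
have b'w' : b' != w'.
  apply: contraNneq aw' => e; have := in_block _ _ abP.
  by rewrite e w'P inE.
have [|/(_ b')] := pairsG a w a' w' aw aw' naw naw'.
  by rewrite !inE (negPf a'a) (negPf a'w).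
by rewrite !inE (negPf b'a) (negPf b'w) (negPf b'w') eq_sym (negPf a'b').
Qed.

End Converse.

(** * Identification of the structures with the named graphs *)

Section Isomorphisms.
Implicit Types G H : sgraph.

Lemma giso_sym G H : giso G H -> giso H G.
Proof.
case=> f [g fK gK] fadj; exists g; first by exists f.
by move=> x y; rewrite -fadj !gK.
Qed.

Lemma clique_star_giso G H c :
  giso G H -> @clique_star H c -> exists d, @clique_star G d.
Proof.
case=> f [g fK gK] fadj [univ trans [x [y [xc yc xy nxy]]]].
have fc z : z != g c -> f z != c by apply: contraNneq => <-; rewrite fK.
have gc z : z != c -> g z != g c by rewrite (can_eq gK).
exists (g c); split.
- by move=> z /fc/univ; rewrite -{1}(gK c) fadj.
- move=> a b d /fc ac /fc bc /fc dc; rewrite -!fadj => ab bd ad.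
  by apply: trans ab bd _; rewrite ?(can_eq fK).
- by exists (g x), (g y); rewrite !gc // (can_eq gK) -fadj !gK.
Qed.

(** The two ends are cliques of size 1 around the middle vertex. *)
Lemma clique_star_path3 : @clique_star (path_graph 3) (inord 1).
Proof.
have e1 : inord 1 = Ordinal (isT : 1 < 3) by apply: val_inj; rewrite /= inordK.
rewrite e1; split.
- by case=> [[|[|[|?]]] ?].
- by do 3!case=> [[|[|[|?]]] ?] //.
- by exists (Ordinal (isT : 0 < 3)), (Ordinal (isT : 2 < 3)).
Qed.

(** Removes the transport [tagged_as] from later adjacency computations. *)
Lemma adj_disjoint_cliques (I : finType) (m : I -> nat)
    (a b : disjoint_union (fun i => complete_graph (m i))) :
  adj a b = (tag a == tag b) && (a != b).
Proof.
case: a b => [i x] [j y] /=; case: (eqVneq i j) => //= ij.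
by case: j / ij y => y; rewrite tagged_asE eq_Tagged.
Qed.

Lemma clique_star_join k (m : 'I_k -> nat) :
  1 < k -> (forall i, 1 <= m i) ->
  @clique_star (join_graph (complete_graph 1)
    (disjoint_union (fun i => complete_graph (m i)))) (inl ord0).
Proof.
move=> k1 m1.
pose H := disjoint_union (fun i => complete_graph (m i)).
pose J := join_graph (complete_graph 1) H.
have adjJ (s t : H) : @adj J (inr s) (inr t) = (tag s == tag t) && (s != t).
  exact: adj_disjoint_cliques.
have inrP (x : J) : x != inl ord0 -> exists s : H, x = inr s.
  by case: x => [i|s]; [rewrite (ord1 i) eqxx | exists s].
split.
- by move=> x /inrP[s ->].
- move=> _ _ _ /inrP[x ->] /inrP[y ->] /inrP[z ->].
  rewrite !adjJ => /andP[/eqP-> _] /andP[-> _].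
  by apply: contraNneq => ->.
(* The first vertices of the cliques with index 0 and 1 are not adjacent. *)
- pose el i : H := Tagged (fun i => 'I_(m i)) (Ordinal (m1 i)).
  exists (inr (el (Ordinal (ltnW k1)))), (inr (el (Ordinal k1))).
  by rewrite adjJ.
Qed.

(** Off [c], being equal or adjacent is an equivalence relation, and its classes are the cliques of
    the union. *)
Lemma clique_star_giso_join G (c : G) : clique_star c ->
  exists (k : nat) (m : 'I_k -> nat),
    [/\ 1 < k, forall i, 1 <= m i, \sum_(i < k) m i = #|G| - 1
      & giso G (join_graph (complete_graph 1)
                  (disjoint_union (fun i => complete_graph (m i))))].
Proof.
case=> univ trans [x0 [y0 [x0c y0c xy0 nxy0]]].
pose R := [rel x y : G | (x == y) || adj x y]; pose D := [set~ c].
have eqR : {in D & &, equivalence_rel R}.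
  move=> x y z; rewrite !inE => xc yc zc; split; first by rewrite /= eqxx.
  have sub (a b d : G) : a != c -> b != c -> d != c -> R a b -> R b d -> R a d.
    move=> ac bc dc /= /predU1P[->//|ab] /predU1P[<-|bd].
      by rewrite ab orbT.
    by case: eqVneq => //= ad; apply: trans ab bd ad.
  have symR (a b : G) : R a b = R b a by rewrite /= eq_sym adj_sym.
  by move=> xy; apply/idP/idP; apply: sub => //; rewrite symR.
pose P := equivalence_partition R D.
have partP : partition P D := equivalence_partitionP eqR.
have pblockR : {in D &, forall x y, (y \in pblock P x) = R x y} :=
  pblock_equivalence_partition eqR.
have inP x : x \in D -> pblock P x \in P.
  by move=> xD; apply: pblock_mem; rewrite (cover_partition partP).
pose m (i : 'I_#|P|) := #|(enum_val i : {set G})|.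
pose H := disjoint_union (fun i => complete_graph (m i)).
(* A vertex with tag [i] and index [j] goes to the [j]-th element of the [i]-th class. *)
pose e (s : H) : G := @enum_val _ (mem (enum_val (tag s) : {set G})) (tagged s).
have eD s : e s \in D.
  rewrite -(cover_partition partP); apply/bigcupP.
  by exists (enum_val (tag s)); [exact: enum_valP | exact: (enum_valP (tagged s))].
have eP s : pblock P (e s) = enum_val (tag s).
  apply: def_pblock; first by case/and3P: partP.
    exact: enum_valP.
  exact: (enum_valP (tagged s)).
have ec s : e s != c by have := eD s; rewrite !inE.
have einj : injective e.
  move=> s t est; have /enum_val_inj : enum_val (tag s) = enum_val (tag t).
    by rewrite -!eP est.
  case: s t est => [i x] [j y] est /= ij.
  by case: j / ij y est => y /enum_val_inj /= ->.
have eadj s t : adj (e s) (e t) = adj s t.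
  rewrite adj_disjoint_cliques -(inj_eq einj) -(inj_eq enum_val_inj) -!eP.
  have tr : trivIset P by case/and3P: partP.
  rewrite eq_pblock ?(cover_partition partP) // pblockR //=.
  by case: eqVneq => [->|_] /=; rewrite ?adj_irr ?andbT.
have sumD : \sum_(i < #|P|) m i = #|G| - 1.
  by rewrite -(big_enum_val (fun A : {set G} => #|A|))
    -(card_partition partP) cardsC1 subn1.
exists #|P|, m; split=> //.
- apply/card_gt1P; exists (pblock P x0), (pblock P y0).
  split; try by apply: inP; rewrite !inE.
  rewrite eq_pblock ?(cover_partition partP) ?inE //; last by case/and3P: partP.
  by rewrite pblockR ?inE //= (negPf xy0).
- move=> i; rewrite card_gt0; apply: contraTneq (enum_valP i) => ->.
  by case/and3P: partP.
apply: giso_sym.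
(* The apex goes to [c]; injectivity and the count [sumD] give bijectivity. *)
exists (fun a => match a with inl _ => c | inr s => e s end).
  apply: inj_card_bij.
    move=> [i|s] [j|t]; first by rewrite (ord1 i) (ord1 j).
    - by move=> ce; have := ec t; rewrite -ce eqxx.
    - by move=> ce; have := ec s; rewrite ce eqxx.
    - by move/einj ->.
  rewrite card_sum card_ord card_tagged sumnE big_map big_enum /=.
  under eq_bigr do rewrite card_ord.
  by rewrite sumD -leq_subLR.
move=> [i|s] [j|t] /=; [by rewrite (ord1 i) (ord1 j) adj_irr| | |exact: eadj].
- by rewrite univ.
- by rewrite adj_sym univ.
Qed.

Lemma delete_edge_nonadj n (u v : complete_graph n) (x y : delete_edge u v) :
  x != y -> ~~ adj x y -> (x = u /\ y = v) \/ (x = v /\ y = u).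
Proof.
move=> xy /=; rewrite xy /= negbK.
by case/orP => /andP[/eqP -> /eqP ->]; [left | right].
Qed.

(** Non-adjacent vertices are opposite; the arithmetic form suits [lia]. *)
Lemma cycle4_nonadj (x y : cycle_graph 4) :
  x != y -> ~~ adj x y -> y = (x + 2) %% 4 :> nat.
Proof. by case: x y => [[|[|[|[|?]]]] ?] // [[|[|[|[|?]]]] ?]. Qed.

Lemma giso_unique_nonneighbor G H :
  giso G H -> unique_nonneighbor H -> unique_nonneighbor G.
Proof.
case=> f /bij_inj finj fadj uniqH x y z yx zx nxy nxz.
by apply/finj/(uniqH (f x)); rewrite ?(inj_eq finj) ?fadj.
Qed.

Lemma giso_pairs_exhaust G H : giso G H -> pairs_exhaust H -> pairs_exhaust G.
Proof.
case=> f /bij_inj finj fadj pairsH u u' v v' uu' vv' nu nv.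
have := pairsH (f u) (f u') (f v) (f v').
rewrite !(inj_eq finj) !fadj => /(_ uu' vv' nu nv)[vin|all_in].
  by left; move: vin; rewrite !inE !(inj_eq finj).
by right=> w; move: (all_in (f w)); rewrite !inE !(inj_eq finj).
Qed.

Lemma delete_edge_unique n (u v : complete_graph n) :
  u != v -> unique_nonneighbor (delete_edge u v).
Proof.
move=> uv x y z; rewrite eq_sym [z == x]eq_sym => yx zx.
move=> /(delete_edge_nonadj yx) nxy /(delete_edge_nonadj zx) nxz.
move/eqP: uv => uv.
by case: nxy => -[xe ->]; case: nxz => -[xe' ->] //; case: uv; rewrite -xe.
Qed.

Lemma delete_edge_pairs n (u v : complete_graph n) :
  pairs_exhaust (delete_edge u v).
Proof.
move=> x x' y y' xx' yy' /(delete_edge_nonadj xx') nx /(delete_edge_nonadj yy') ny.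
by left; rewrite !inE; case: nx => -[-> ->]; case: ny => -[-> _];
  rewrite eqxx ?orbT.
Qed.

Lemma cycle4_unique : unique_nonneighbor (cycle_graph 4).
Proof.
move=> x y z; rewrite eq_sym [z == x]eq_sym => yx zx.
move=> /(cycle4_nonadj yx) nxy /(cycle4_nonadj zx) nxz.
by apply: val_inj; rewrite /= nxy nxz.
Qed.

Lemma cycle4_pairs : pairs_exhaust (cycle_graph 4).
Proof.
move=> u u' v v' uu' vv' /(cycle4_nonadj uu') nu /(cycle4_nonadj vv') nv.
case: (boolP (v \in [:: u; u'])) => [|vn]; [by left | right => w].
move: vn; rewrite !inE -!val_eqE /= nu nv.
have := ltn_ord u; have := ltn_ord v; have := ltn_ord w; lia.
Qed.

(** A second non-adjacent pair [v], [v'] exhausts the graph and gives the cycle [u], [v], [u'],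
    [v']. Without one, [u], [u'] is the only missing edge. *)
Lemma pairs_exhaust_giso G (u u' : G) :
    unique_nonneighbor G -> pairs_exhaust G -> u != u' -> ~~ adj u u' ->
  giso G (cycle_graph 4) \/
  exists a b : complete_graph #|G|, a != b /\ giso G (delete_edge a b).
Proof.
move=> uniqG pairsG uu' nuu'.
have sym (x y : G) : adj x y = adj y x := adj_sym x y.
pose Q (v v' : G) := [&& v != v', ~~ adj v v' & v \notin [:: u; u']].
have [/existsP[v /existsP[v' /and3P[vv' nvv' vn]]]|nQ] :=
    boolP [exists v, exists v', Q v v'].
  left; apply: giso_sym.
  have [vin|all4] := pairsG u u' v v' uu' vv' nuu' nvv'.
    by rewrite vin in vn.
  have adj_of := unique_nonneighbor_adj uniqG.
  move: vn; rewrite !inE negb_or => /andP[vu vu'].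
  (* Both [u] and [u'] already have each other as their only non-neighbour. *)
  have v'u : v' != u.
    apply: contraNneq vu' => e; apply/eqP/(uniqG u); rewrite // 1?eq_sym //.
    by rewrite -e sym.
  have v'u' : v' != u'.
    apply: contraNneq vu => e; apply/eqP/(uniqG u'); rewrite ?(sym u') //.
    by rewrite -e.
  have u'u : u' != u by rewrite eq_sym.
  have nu'u : ~~ adj u' u by rewrite sym.
  have uv := adj_of _ _ _ uu' nuu' vu vu'.
  have uv' := adj_of _ _ _ uu' nuu' v'u v'u'.
  have u'v := adj_of _ _ _ u'u nu'u vu' vu.
  have u'v' := adj_of _ _ _ u'u nu'u v'u' v'u.
  pose s := [:: u; v; u'; v'].
  have us : uniq s.
    by rewrite /= !inE !negb_or vu' vv' !(eq_sym u) vu u'u v'u eq_sym v'u'.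
  exists (fun i : 'I_4 => nth u s i).
    apply: inj_card_bij => [i j /eqP|].
      by rewrite nth_uniq // => /eqP/val_inj.
    rewrite card_ord -[leqRHS]/(size s); apply: leq_trans (card_size s).
    apply/subset_leq_card/subsetP => w _; have := all4 w; rewrite !inE.
    by do !case: eqP => //=.
  have adjE := (uv, uv', u'v, u'v', negPf nuu', negPf nvv').
  move=> [[|[|[|[|i]]]] pi] // [[|[|[|[|j]]]] pj] //=;
    by rewrite ?adj_irr ?adjE // sym adjE.
right; exists (enum_rank u), (enum_rank u').
rewrite (inj_eq enum_rank_inj); split=> //.
exists enum_rank; first exact: enum_rank_bij.
move=> x y /=; rewrite !(inj_eq enum_rank_inj).
case: (eqVneq x y) => [->|xy]; first by rewrite adj_irr.
apply/idP/idP => [|xyadj]; last first.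
  apply: contraTN xyadj; case/orP=> /andP[/eqP -> /eqP ->] //.
  by rewrite sym.
apply: contraTT => nxy; rewrite negbK /=.
(* Since no second pair exists, [x] is [u] or [u'], and [y] is its unique non-neighbour. *)
have /existsPn/(_ x)/existsPn/(_ y) := nQ.
rewrite /Q xy nxy negbK !inE /= => /orP[] /eqP xe; rewrite xe in xy nxy *;
  rewrite eqxx; apply/orP; [left|right]; apply/eqP.
- by apply: (uniqG u); rewrite // eq_sym.
- by apply: (uniqG u') => //; [rewrite eq_sym | rewrite sym].
Qed.

End Isomorphisms.

Theorem theorem18 (G : sgraph) (n : nat) (hG : connected_graph G)
    (hn : #|G| = n) :
  pd_s G = n - 1 <->
  [\/ giso G (path_graph 3),
      giso G (cycle_graph 4),
      exists u v : complete_graph n,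
        u != v /\ giso G (delete_edge u v)
    | exists (k : nat) (m : 'I_k -> nat),
        [/\ 1 < k, forall i, 1 <= m i, \sum_(i < k) m i = n - 1
          & giso G (join_graph (complete_graph 1)
                      (disjoint_union (fun i => complete_graph (m i))))]].
Proof.
subst n; split=> [pdG|].
  have [[c starc]|[uniqG pairsG]] := extremal_structure hG pdG.
    by apply: Or44; apply: clique_star_giso_join starc.
  have [u [v [uv nuv]]] := extremal_not_complete hG pdG.
  by case: (pairs_exhaust_giso uniqG pairsG uv nuv); [apply: Or42 | apply: Or43].
case=> [iso|iso|[u [v [uv iso]]]|[k [m [k1 m1 _ iso]]]].
- have [c starc] := clique_star_giso iso clique_star_path3.
  exact: clique_star_pd_s starc.
- have [f [g fK gK] fadj] := iso.
  (* The opposite vertices 0 and 2 supply the non-adjacent pair. *)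
  apply: (pairs_exhaust_pd_s hG (u0 := g (inord 0)) (v0 := g (inord 2))).
  + exact: giso_unique_nonneighbor iso cycle4_unique.
  + exact: giso_pairs_exhaust iso cycle4_pairs.
  + by rewrite (can_eq gK) -val_eqE /= !inordK.
  + by rewrite -fadj !gK /= !inordK // andbF.
- have [f [g fK gK] fadj] := iso.
  apply: (pairs_exhaust_pd_s hG (u0 := g u) (v0 := g v)).
  + exact: giso_unique_nonneighbor iso (delete_edge_unique uv).
  + exact: giso_pairs_exhaust iso (@delete_edge_pairs _ u v).
  + by rewrite (can_eq gK).
  + by rewrite -fadj !gK /= !eqxx andbF.
- have [c starc] := clique_star_giso iso (clique_star_join k1 m1).
  exact: clique_star_pd_s starc.
Qed.
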